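(* Let $G$ be a connected graph and $N\subseteq V(G)$ a non-empty set of pairwise non-adjacent vertices. Suppose $G/N$ has a well-balanced orientation, and let $\vec G$ be the orientation of $G$ it induces. Then the simple graph $L(\vec G,N)$ is connected.
   Context: Graphs may have parallel edges but no loops. $G/N$ is obtained by identifying all vertices of $N$ into a single vertex while keeping all edges; an orientation of $G/N$ induces an orientation of $G$ on the same edge set. For an oriented graph $\vec G$ and $N\subseteq V(G)$, $L(\vec G,N)$ is the simple graph with vertex set $N$ in which distinct $x,y\in N$ are adjacent iff $\vec G$ contains a directed path from $x$ to $y$ or from $y$ to $x$. $\lambda(a,b)$ ($\vec\lambda(a,b)$) is the cardinal maximum number of pairwise edge-disjoint (directed) $a$–$b$ paths; an orientation is well-balanced if for all distinct $a,b$: $\vec\lambda(a,b)\ge\lfloor\lambda(a,b)/2\rfloor$ if $\lambda(a,b)$ is finite, and $\vec\lambda(a,b)\ge\lambda(a,b)$ otherwise. *)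

(* Defs.v *)
From HB Require Import structures.
From mathcomp Require Import all_boot.
From mathcomp Require Import boolp classical_sets functions cardinality.

Set Implicit Arguments.
Unset Strict Implicit.
Unset Printing Implicit Defensive.

Local Open Scope classical_set_scope.
Local Open Scope card_scope.

(* Graphs may be infinite.  Every type classically carries a choiceType        *)
(* structure (boolp), so taking choiceTypes for vertices and edges costs no    *)
(* generality; it only provides decidable equality.                            *)
Record graph := Graph {
  vertex : choiceType;
  edge : choiceType;
  ends : edge -> set vertex;
  ends_pair : forall e, exists x y, x <> y /\ ends e = [set x; y] }.

Record orientation (G : graph) := Orientation {
  tail : edge G -> vertex G;
  head : edge G -> vertex G;
  endsE : forall e, ends e = [set tail e; head e] }.

Section Paths.
Variables V E : choiceType.

(* [step e u v]: the edge e may be traversed from u to v.  A walk from a is    *)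
(* the sequence of its steps, each given by the edge used and the vertex       *)
(* reached.                                                                    *)
Variable step : E -> V -> V -> Prop.

Fixpoint is_walk (a : V) (p : seq (E * V)) (b : V) : Prop :=
  if p is (e, v) :: p' then step e a v /\ is_walk v p' b else a = b.

Definition is_path (a : V) (p : seq (E * V)) (b : V) : Prop :=
  is_walk a p b /\ uniq (a :: unzip2 p).

Definition edge_disjoint_paths (a b : V) (F : set (seq (E * V))) : Prop :=
  (forall p, F p -> is_path a p b) /\
  (forall p q, F p -> F q -> p <> q ->
     forall e, ~ (e \in unzip1 p /\ e \in unzip1 q)).

Definition is_max_edge_disjoint (a b : V) (F : set (seq (E * V))) : Prop :=
  edge_disjoint_paths a b F /\
  forall F', edge_disjoint_paths a b F' -> F' #<= F.

(* The cardinal maximum number of edge-disjoint a-b paths, represented by a    *)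
(* set of that cardinality; it is attained when a <> b, see                    *)
(* [max_edge_disjointP].                                                       *)
Definition max_edge_disjoint (a b : V) : set (seq (E * V)) :=
  xget set0 [set F | is_max_edge_disjoint a b F].

End Paths.

Definition ustep (G : graph) (e : edge G) (u v : vertex G) : Prop :=
  ends e = [set u; v].

Definition dstep (G : graph) (O : orientation G) (e : edge G)
  (u v : vertex G) : Prop := tail O e = u /\ head O e = v.

Definition lambda (G : graph) (a b : vertex G) :=
  max_edge_disjoint (@ustep G) a b.

Definition dlambda (G : graph) (O : orientation G) (a b : vertex G) :=
  max_edge_disjoint (dstep O) a b.

Definition well_balanced (G : graph) (O : orientation G) : Prop :=
  forall a b : vertex G, a <> b ->
    (forall n, lambda a b #= `I_n -> `I_(n./2) #<= dlambda O a b) /\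
    (infinite_set (lambda a b) -> lambda a b #<= dlambda O a b).

Definition connected (G : graph) : Prop :=
  (exists x : vertex G, True) /\
  forall x y : vertex G, exists p, is_path (@ustep G) x p y.

Definition adjacent (G : graph) (x y : vertex G) : Prop :=
  exists e : edge G, ends e = [set x; y].

Definition independent (G : graph) (N : set (vertex G)) : Prop :=
  forall x y, N x -> N y -> ~ adjacent x y.

Section Contraction.
Variables (G : graph) (N : set (vertex G)).

(* The vertices of G/N: [None] is the vertex obtained from N.                  *)
Definition contract_vertex : choiceType := option {x : vertex G | x \notin N}.

Definition contract_map (x : vertex G) : contract_vertex := insub x.

Lemma contract_map_eq x y :
  contract_map x = contract_map y -> x = y \/ (N x /\ N y).
Proof.
rewrite /contract_map; case: insubP => [u xN ux|/negPn/set_mem Nx];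
  case: insubP => [v yN vy|/negPn/set_mem Ny] //; last by right.
by move=> [uv]; left; rewrite -ux -vy uv.
Qed.

Hypothesis indN : independent N.

Lemma contract_ends_pair (e : edge G) : exists x y,
  x <> y /\ contract_map @` ends e = [set x; y].
Proof.
have [x [y [xy exy]]] := ends_pair e.
exists (contract_map x), (contract_map y); split; last first.
  by rewrite exy image_setU !image_set1.
by move=> /contract_map_eq[//|[Nx Ny]]; apply: (indN Nx Ny); exists e.
Qed.

Definition contract : graph :=
  @Graph contract_vertex (edge G) (fun e => contract_map @` ends e)
    contract_ends_pair.

Definition induces (O' : orientation contract) (O : orientation G) : Prop :=
  forall e : edge G,
    contract_map (tail O e) = tail O' e /\ contract_map (head O e) = head O' e.

End Contraction.

Record sgraph := SGraph {
  svertex : choiceType;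
  sadj : svertex -> svertex -> Prop;
  sadj_sym : forall x y, sadj x y -> sadj y x;
  sadj_irr : forall x, ~ sadj x x }.

Definition sconnected (H : sgraph) : Prop :=
  (exists x : svertex H, True) /\
  forall x y : svertex H, exists p : seq (svertex H),
    [/\ path (fun u v => `[< sadj u v >]) x p, uniq (x :: p) & last x p = y].

Section LinkGraph.
Variables (G : graph) (O : orientation G) (N : set (vertex G)).

Definition link_adj (x y : {x : vertex G | x \in N}) : Prop :=
  x <> y /\ ((exists p, is_path (dstep O) (val x) p (val y)) \/
             (exists p, is_path (dstep O) (val y) p (val x))).

Lemma link_adj_sym x y : link_adj x y -> link_adj y x.
Proof. by move=> [xy H]; split; [exact: nesym|case: H; [right|left]]. Qed.

Lemma link_adj_irr x : ~ link_adj x x.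
Proof. by move=> []. Qed.

Definition L : sgraph := SGraph link_adj_sym link_adj_irr.

End LinkGraph.

Lemma contract_map_inj (G : graph) (N : set (vertex G)) (e : edge G) x y :
  independent N -> ends e x -> ends e y ->
  contract_map N x = contract_map N y -> x = y.
Proof.
move=> indN ex ey /contract_map_eq[//|[Nx Ny]].
have [u [v [uv E]]] := ends_pair e; move: ex ey; rewrite E.
move=> [] xE [] yE; rewrite ?xE ?yE //; exfalso; apply: (indN _ _ Nx Ny);
  by exists e; rewrite E xE yE // setUC.
Qed.

Lemma induces_exists_unique (G : graph) (N : set (vertex G))
    (indN : independent N) (O' : orientation (contract indN)) :
  exists2 O : orientation G, induces O' O &
    forall O1, induces O' O1 -> tail O1 =1 tail O /\ head O1 =1 head O.
Proof.
have th e : exists th : vertex G * vertex G, ends e = [set th.1; th.2] /\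
    contract_map N th.1 = tail O' e /\ contract_map N th.2 = head O' e.
  have [x [y [xy exy]]] := ends_pair e.
  have qe : [set contract_map N x; contract_map N y] = [set tail O' e; head O' e].
    have <- : @ends (contract indN) e = [set tail O' e; head O' e] by exact: endsE.
    by rewrite /= exy image_setU !image_set1.
  have cxy : contract_map N x <> contract_map N y.
    by move=> /(contract_map_inj indN)-/(_ e); rewrite exy => c; apply/xy/c; [left|right].
  have : [set tail O' e; head O' e] (contract_map N x) by rewrite -qe; left.
  have : [set tail O' e; head O' e] (contract_map N y) by rewrite -qe; right.
  move=> /= H1 H2.
  case: H2 => H2; case: H1 => H1; first by rewrite H2 H1 in cxy.
  - by exists (x, y).
  - by exists (y, x); rewrite exy setUC.
  - by rewrite H2 H1 in cxy.
pose f e := projT1 (cid (th e)); have fP e := projT2 (cid (th e)).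
exists (@Orientation G (fun e => (f e).1) (fun e => (f e).2) (fun e => (fP e).1)).
  by move=> e; exact: (fP e).2.
move=> O1 i1; split=> e /=; have [E1 [E2 E3]] := fP e;
  rewrite -/(f e) in E1 E2 E3; have [t1 h1] := i1 e;
  apply: (contract_map_inj (e := e) indN); rewrite ?E2 ?E3 //;
  by [rewrite E1; left|rewrite E1; right|rewrite (endsE O1); left|rewrite (endsE O1); right].
Qed.

Section Maximum.

Lemma card_le_inj T U (A : set T) (B : set U) (f : T -> U) :
  (forall x, A x -> B (f x)) ->
  (forall x y, A x -> A y -> f x = f y -> x = y) -> A #<= B.
Proof.
move=> fAB finj.
have /card_esym fA : f @` A #= A.
  by apply: inj_card_eq => x y /set_mem Ax /set_mem Ay; exact: finj.
rewrite (card_le_eql fA); apply: subset_card_le => _ [x Ax <-]; exact: fAB.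
Qed.

Lemma infinite_setX_nat (T : pointedType) (A : set T) :
  infinite_set A -> A `*` [set: nat] #<= A.
Proof.
move=> Ainf.
pose P (D : set (set T)) :=
  (forall C, D C -> [/\ C `<=` A, infinite_set C & countable C]) /\
  (forall C C' x, D C -> D C' -> C x -> C' x -> C = C').
have sub_count (X : set T) : infinite_set X ->
    exists C, [/\ C `<=` X, infinite_set C & countable C].
  move=> /infiniteP /pcard_leP [f]; exists (range f); split.
  - by move=> _ [n _ <-]; exact: funS.
  - have fE : range f #= [set: nat].
      by apply: inj_card_eq => x y _ _; apply: (@inj _ _ _ f); rewrite inE.
    by rewrite (eq_finite_set fE); exact: infinite_nat.
  - exact: card_image_le.
have [|D [[D1 D2] Dmax]] := @Zorn_bigcup _ P.
  move=> F FP Ftot; split=> [C [X FX XC]|C C' x [X FX XC] [Y FY YC']].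
    exact: (FP _ FX).1.
  by case: (Ftot _ _ FX FY) => XY; [apply: (FP _ FY).2 => //|apply: (FP _ FX).2 => //];
    exact: XY.
pose R := A `\` \bigcup_(C in D) C.
have Rfin : finite_set R.
  apply: contrapT => /sub_count [C [CR Cinf Ccnt]].
  have [x Cx] := infinite_setN0 Cinf.
  apply: (Dmax (D `|` [set C])).
    split; first by move=> X DX; left.
    by move=> /(_ C (or_intror erefl)) DC; have [_] := CR _ Cx; apply; exists C.
  have nC X y : D X -> X y -> C y -> False.
    by move=> DX Xy /CR[_]; apply; exists X.
  split=> [X [/D1//|->]|X Y y [DX|->] [DY|->] Xy Yy //].
  - by split=> // y /CR[].
  - exact: (D2 _ _ y).
  - by case: (nC X y).
  - by case: (nC Y y).
have [C0 DC0] : exists C, D C.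
  apply: contrapT => nD; apply: Ainf; apply: sub_finite_set Rfin.
  by move=> x Ax; split=> // -[C DC _]; apply: nD; exists C.
have [h hP] : {h : T -> set T & forall x, A x -> D (h x) /\ (h x x \/ h x = C0 /\ R x)}.
  apply: (@choice _ _ (fun x C => A x -> D C /\ (C x \/ C = C0 /\ R x))) => x.
  have [Rx|nRx] := pselect (R x); first by exists C0 => _; split=> //; right.
  have [Ax|nAx] := pselect (A x); last by exists set0.
  have [C [DC Cx]] : exists C, D C /\ C x.
    by apply: contrapT => nC; apply: nRx; split=> // -[C DC Cx]; apply: nC; exists C.
  by exists C => _; split=> //; left.
have [i iP] : {i : set T -> T -> nat & forall C, D C ->
    forall x y, (C `|` R) x -> (C `|` R) y -> i C x = i C y -> x = y}.
  apply: (@choice _ _ (fun C i => D C ->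
    forall x y, (C `|` R) x -> (C `|` R) y -> i x = i y -> x = y)) => C.
  have [DC|nDC] := pselect (D C); last by exists (fun=> 0).
  have /countable_injP[f fi] : countable (C `|` R).
    rewrite -bigcup2inE; apply: bigcup_countable; first exact: finite_set_countable.
    by move=> [|[|n]] //= _; [case: (D1 _ DC)|exact: finite_set_countable].
  by exists f => _ x y Cx Cy; apply: fi; rewrite inE.
have [e eP] : {e : set T -> nat -> T & forall C, D C ->
    (forall n, C (e C n)) /\ injective (e C)}.
  apply: (@choice _ _ (fun C e => D C -> (forall n, C (e n)) /\ injective e)) => C.
  have [DC|nDC] := pselect (D C); last by exists (fun=> point).
  have [_ /infiniteP/pcard_leP[f] _] := D1 _ DC.
  exists f => _; split=> [n|m n]; first exact: funS.
  by apply: (@inj _ _ _ f); rewrite inE.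
apply: (@card_le_inj _ _ _ _ (fun xn => e (h xn.1) (pickle (i (h xn.1) xn.1, xn.2)))).
  move=> [x n] [/= Ax _]; have [Dh _] := hP _ Ax.
  by have [CA _ _] := D1 _ Dh; apply: CA; exact: (eP _ Dh).1.
move=> [x m] [y n] [/= Ax _] [/= Ay _] exy.
have [Dx hx] := hP _ Ax; have [Dy hy] := hP _ Ay.
have hxy : h x = h y.
  apply: (D2 _ _ (e (h x) (pickle (i (h x) x, m))) Dx Dy).
    exact: (eP _ Dx).1.
  rewrite exy; exact: (eP _ Dy).1.
rewrite hxy in exy hx.
have /(pcan_inj pickleK)[ixy ->] := (eP _ Dy).2 _ _ exy.
congr pair; apply: (iP _ Dy) ixy; first by case: hx => [?|[]]; [left|right].
by case: hy => [?|[]]; [left|right].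
Qed.

Variables (V E : choiceType) (step : E -> V -> V -> Prop) (a b : V).
Hypothesis ab : a <> b.

Lemma max_edge_disjoint_exists : exists F, is_max_edge_disjoint step a b F.
Proof.
pose P := edge_disjoint_paths step a b.
have [|M [MP Mmax]] := @Zorn_bigcup _ P.
  move=> F FP Ftot; split=> [p [X FX Xp]|p q [X FX Xp] [Y FY Yq]].
    exact: (FP _ FX).1.
  by case: (Ftot _ _ FX FY) => XY; [apply: (FP _ FY).2 => //|apply: (FP _ FX).2 => //];
    exact: XY.
pose EM := [set e | exists2 p, M p & e \in unzip1 p].
have leEM F : P F -> F #<= EM.
  move=> FP.
  have hit p : F p -> exists2 e, e \in unzip1 p & EM e.
    move=> Fp; apply: contrapT => nhit.
    have Pp := FP.1 _ Fp.
    have [e ep] : exists e, e \in unzip1 p.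
      case: (p) Pp => [[/= /ab//]|[e v] p' _]; exists e.
      by rewrite /= inE eqxx.
    have nMp : ~ M p by move=> Mp; apply: nhit; exists e => //; exists p.
    apply: (Mmax (M `|` [set p])).
      split; first by move=> X MX; left.
      by move=> /(_ p (or_intror erefl)).
    split=> [q [/(MP.1 _)//|->//]|q r [Mq|->] [Mr|->] qr f [fq fr] //].
    - exact: (MP.2 _ _ Mq Mr qr f).
    - by apply: nhit; exists f => //; exists q.
    - by apply: nhit; exists f => //; exists r.
  have [->|/set0P[p0 Fp0]] := eqVneq F set0; first exact: card_ge0.
  have [e0 _ _] := hit _ Fp0.
  have [g gP] : {g : seq (E * V) -> E &
      forall p, F p -> g p \in unzip1 p /\ EM (g p)}.
    apply: (@choice _ _ (fun p e => F p -> e \in unzip1 p /\ EM e)) => p.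
    have [Fp|nFp] := pselect (F p); last by exists e0.
    by have [e] := hit _ Fp; exists e.
  apply: (@card_le_inj _ _ _ _ g) => [p Fp|p q Fp Fq gpq]; first exact: (gP _ Fp).2.
  apply: contrapT => pq; apply: (FP.2 _ _ Fp Fq pq (g p)).
  by split; [exact: (gP _ Fp).1|rewrite gpq; exact: (gP _ Fq).1].
have [Mfin|Minf] := pselect (finite_set M).
  have /finite_setP[n nE] : finite_set EM.
    rewrite (_ : EM = \bigcup_(p in M) [set` unzip1 p]); last first.
      by apply/seteqP; split=> e [p]; exists p.
    by apply: bigcup_finite => // p _; exact: finite_seq.
  pose Q m := `[< exists2 F, P F & F #= `I_m >].
  have Q0 : exists m, Q m.
    have [m mE] := (finite_setP M).1 Mfin.
    by exists m; apply/asboolP; exists M.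
  have Qle m : Q m -> m <= n.
    move=> /asboolP[F /leEM FE Fm].
    by rewrite -card_le_II -(card_le_eql Fm) -(card_le_eqr nE).
  have [m /asboolP[F FP Fm] mmax] := ex_maxnP Q0 Qle.
  exists F; split=> // F' F'P.
  have /finite_setP[k kE] : finite_set F'.
    by apply: card_le_finite (leEM _ F'P) _; apply/finite_setP; exists n.
  rewrite (card_le_eql kE) (card_le_eqr Fm) card_le_II; apply: mmax.
  by apply/asboolP; exists F'.
exists M; split=> // F /leEM FE; apply: card_le_trans FE _.
have [p0 Mp0] := infinite_setN0 Minf.
pose T := HB.pack_for pointedType (seq (E * V)) (isPointed.Build (seq (E * V)) p0).
apply: card_le_trans (@infinite_setX_nat T M Minf).
have [g gP] : {g : E -> seq (E * V) &
    forall e, EM e -> M (g e) /\ e \in unzip1 (g e)}.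
  apply: (@choice _ _ (fun e p => EM e -> M p /\ e \in unzip1 p)) => e.
  have [[p Mp ep]|nEM] := pselect (EM e); last by exists p0.
  by exists p.
apply: (@card_le_inj _ _ _ _ (fun e => (g e, index e (unzip1 (g e))))).
  by move=> e /gP[].
move=> e f /gP[_ eg] /gP[_ fg] [gef].
by rewrite gef in eg *; exact: index_inj.
Qed.

Lemma max_edge_disjointP :
  is_max_edge_disjoint step a b (max_edge_disjoint step a b).
Proof. exact: (@xgetPex _ _ [set F | _]) max_edge_disjoint_exists. Qed.

End Maximum.

(* Main.v *)
Require Import Defs.
From mathcomp Require Import all_boot.
From mathcomp Require Import boolp classical_sets functions cardinality.

Local Open Scope classical_set_scope.
Local Open Scope card_scope.

(** Let [x] and [y] be in [N] and let [P] be an [x]-[y] path of [G].  In [G/N]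
    the two pieces of [P] at a vertex [v] outside [N] are edge-disjoint walks
    from [v] to the contracted vertex, so well-balancedness yields directed
    paths between [v] and the contracted vertex in both directions; lifted to
    [G], they show that every vertex of [P] is reachable from [N] and reaches
    [N].  Hence all the members of [N] comparable with a given vertex of [P] by
    reachability lie in one component of [L], and consecutive vertices of [P]
    share such a member. *)

(** * Walks, reachability and the removal of repeated vertices *)

Definition reach {V E : choiceType} (step : E -> V -> V -> Prop) (a b : V) :
  Prop := exists p, is_walk step a p b.

Section Walks.
Context {V E : choiceType} {step : E -> V -> V -> Prop}.
Implicit Types (a b c : V) (p q : seq (E * V)).

Lemma walk_cat {a p b q c} :
  is_walk step a p b -> is_walk step b q c -> is_walk step a (p ++ q) c.
Proof.
elim: p a => [|[e v] p IH] a /=; first by move=> ->.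
by move=> [sav wp] wq; split=> //; exact: IH.
Qed.

Lemma walk_last {a p b} : is_walk step a p b -> last a (unzip2 p) = b.
Proof. by elim: p a => [|[e v] p IH] a //= [_ /IH]. Qed.

Lemma reachxx {a} : reach step a a.
Proof. by exists [::]. Qed.

Lemma reach_trans {b a c} :
  reach step a b -> reach step b c -> reach step a c.
Proof. by move=> [p wp] [q wq]; exists (p ++ q); exact: walk_cat wp wq. Qed.

Lemma reach_step e {a b} : step e a b -> reach step a b.
Proof. by move=> sab; exists [:: (e, b)]. Qed.

Lemma walk_split_at {a p b v} : is_walk step a p b -> v \in a :: unzip2 p ->
  exists p1 p2,
    [/\ p = p1 ++ p2, is_walk step a p1 v & is_walk step v p2 b].
Proof.
elim: p a => [|[e w] p IH] a /=.
  by move=> <-; rewrite inE => /eqP ->; exists [::], [::].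
move=> [saw wp]; rewrite inE => /orP[/eqP ->|/(IH _ wp)].
  by exists [::], ((e, w) :: p).
by move=> [p1 [p2 [-> w1 w2]]]; exists ((e, w) :: p1), p2.
Qed.

(** If the start recurs later, everything before that recurrence is dropped. Keeping track of the
    edges lets edge-disjointness of walks pass to the shortened paths. *)
Lemma walk_shorten {a p b} : is_walk step a p b ->
  exists2 q, is_path step a q b & {subset unzip1 q <= unzip1 p}.
Proof.
elim: p a => [|[e v] p IH] a /=; first by move=> <-; exists [::].
move=> [sav /IH[q [wq uq] qp]].
have [aq|aq] := boolP (a \in v :: unzip2 q).
  have [q1 [q2 [qE /walk_last w1 w2]]] := walk_split_at wq aq.
  exists q2; last first.
    move=> f fq; rewrite inE qp ?orbT //.
    by rewrite qE /unzip1 map_cat mem_cat fq orbT.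
  split=> //; move: uq; rewrite qE /unzip2 map_cat -cat_cons cat_uniq.
  move=> /and3P[_ /hasPn disj uq2]; rewrite /= uq2 andbT.
  by apply/negP => /disj; rewrite -w1 mem_last.
exists ((e, v) :: q); last first.
  by move=> f; rewrite !inE => /orP[->//|/qp ->]; rewrite orbT.
by split=> //=; move: uq aq => /= -> ->.
Qed.

End Walks.

(** The two walks force $\lambda(a,b)\ge 2$, so $\lfloor\lambda(a,b)/2\rfloor\ge 1$ when
    $\lambda(a,b)$ is finite; in either case the maximum family of directed paths is non-empty. *)
Lemma two_edge_disjoint_walks_reach {G : graph} {O : orientation G} {a b p q} :
  well_balanced O -> a <> b ->
  is_walk (@ustep G) a p b -> is_walk (@ustep G) a q b ->
  (forall e, e \in unzip1 p -> e \in unzip1 q -> False) ->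
  reach (dstep O) a b.
Proof.
move=> wb ab /walk_shorten[p' pp' sp] /walk_shorten[q' pq' sq] disj.
(* Since $a\ne b$, a path from [a] to [b] has an edge, so equal paths would share one. *)
have p'q' : p' <> q'.
  move=> E; case: p' E pp' sp => [|[e v] r] E pp' sp.
    by case: pp' => /= /ab.
  have er : e \in unzip1 ((e, v) :: r) by rewrite inE eqxx.
  by apply: (disj e); [exact: sp|apply: sq; rewrite -E].
have FP : edge_disjoint_paths (@ustep G) a b [set p'; q'].
  split=> [r [->|->]//|r s [->|->] [->|->] rs e [er es] //].
    by apply: (disj e); [exact: sp|exact: sq].
  by apply: (disj e); [exact: sp|exact: sq].
have [_ /(_ _ FP) Fle] := max_edge_disjointP (@ustep G) ab.
have two : `I_2 #<= [set p'; q'].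
  apply: (@card_le_inj _ _ _ _ (fun i => if i == 0 then p' else q')).
    by move=> [|i] _; [left|right].
  by move=> [|[|i]] [|[|j]] //= _ _ E; exfalso; apply: p'q'.
have [r dr] : dlambda O a b !=set0.
  apply/set0P/negP => /eqP d0.
  have [fin inf] := wb a b ab.
  have [/finite_setP[n nE]|linf] := pselect (finite_set (lambda a b)).
    have n2 : 2 <= n.
      rewrite -card_le_II -(card_le_eqr nE); exact: card_le_trans two Fle.
    have := fin n nE; rewrite d0 card_le0 => /eqP I0.
    have : `I_(n./2) 0 by rewrite /= half_gt0.
    by rewrite I0.
  have := inf linf; rewrite d0 card_le0 => /eqP l0.
  by apply: linf; rewrite l0.
have [[dP _] _] := max_edge_disjointP (dstep O) ab.
by have [wr _] := dP _ dr; exists r.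
Qed.

(** * Undirected walks: reversal and splitting at a vertex *)

Section UndirectedWalks.
Context {G : graph}.
Implicit Types (a b : vertex G) (p : seq (edge G * vertex G)).

Lemma uwalk_rev {a p b} : is_walk (@ustep G) a p b ->
  exists2 q, is_walk (@ustep G) b q a & unzip1 q =i unzip1 p.
Proof.
elim: p a => [|[e v] p IH] a /=; first by move=> ->; exists [::].
move=> [sav /IH[q wq qp]]; exists (q ++ [:: (e, a)]).
  apply: walk_cat wq _; split=> //.
  by rewrite /ustep setUC.
by move=> f; rewrite /unzip1 map_cat mem_cat !inE qp orbC.
Qed.

Lemma uwalk_ends {a p b e} : is_walk (@ustep G) a p b -> e \in unzip1 p ->
  forall u, ends e u -> u \in a :: unzip2 p.
Proof.
elim: p a => [|[f v] p IH] a //= [sav wp].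
rewrite inE => /orP[/eqP ->|ep] u.
  by rewrite sav => -[] ->; rewrite !inE eqxx ?orbT.
by move=> /(IH _ wp ep) uvp; rewrite inE uvp orbT.
Qed.

(** Both ends of a shared edge would lie on both pieces, which meet only in [v]; but an edge has two
    distinct ends. *)
Lemma upath_split_edge_disjoint {a p1 v p2 b} :
  is_walk (@ustep G) a p1 v -> is_walk (@ustep G) v p2 b ->
  uniq (a :: unzip2 (p1 ++ p2)) ->
  forall e, e \in unzip1 p1 -> e \in unzip1 p2 -> False.
Proof.
move=> w1 w2; rewrite /unzip2 map_cat -cat_cons cat_uniq.
move=> /and3P[_ /hasPn disj _] e e1 e2.
have ev u : ends e u -> u = v.
  move=> eu; have := uwalk_ends w2 e2 _ eu.
  rewrite inE => /orP[/eqP//|/disj].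
  by rewrite /= (uwalk_ends w1 e1 _ eu).
have [s [t [st eE]]] := ends_pair e.
by apply: st; apply: etrans (esym _); apply: ev; rewrite eE; [left|right].
Qed.

End UndirectedWalks.

(** * Lifting directed walks from the contraction to the graph *)

Definition between {G : graph} (O : orientation G) (N : set (vertex G)) v :
  Prop :=
  (exists2 n, N n & reach (dstep O) v n) /\
  (exists2 n, N n & reach (dstep O) n v).

Lemma ustep_reach {G : graph} (O : orientation G) {e a b} :
  ustep e a b -> reach (dstep O) a b \/ reach (dstep O) b a.
Proof.
move=> sab; have st : reach (dstep O) (tail O e) (Defs.head O e).
  exact: (reach_step e).
have [tin hin] : [set a; b] (tail O e) /\ [set a; b] (Defs.head O e).
  by rewrite -sab (endsE O); split; [left|right].
(* Absence of loops excludes the cases where tail and head are the same end. *)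
have th : tail O e <> Defs.head O e.
  move=> th; have [s [t [est]]] := ends_pair e.
  rewrite (endsE O) th setUid => eE; apply: est.
  have -> : [set Defs.head O e] s by rewrite eE; left.
  by have -> : [set Defs.head O e] t by rewrite eE; right.
by case: tin hin th st => -> [] -> // _ st; [left|right].
Qed.

Section Contraction.
Context {G : graph} {N : set (vertex G)} {indN : independent N}.
Let cm := contract_map N.

Lemma contract_map_None {v} : cm v = None <-> N v.
Proof.
rewrite /cm /contract_map; case: insubP => [u vN uv|/negPn/set_mem//].
by split=> // Nv; move: vN; rewrite mem_set.
Qed.

Lemma contract_uwalk {a p b} : is_walk (@ustep G) a p b ->
  is_walk (@ustep (contract indN)) (cm a) [seq (x.1, cm x.2) | x <- p] (cm b).
Proof.
elim: p a => [|[e v] p IH] a /=; first by move=> ->.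
move=> [sav /IH wp]; split=> //.
by rewrite /ustep /= sav image_setU !image_set1.
Qed.

Context {O' : orientation (contract indN)} {O : orientation G}.
Hypothesis O'O : induces O' O.

(** The walk is lifted edge by edge from [v]. The next edge fails to start at the current vertex
    only if that vertex is already in [N], and then the lift stops there. *)
Lemma reach_contract_lift v : reach (dstep O') (cm v) None ->
  exists2 n, N n & reach (dstep O) v n.
Proof.
move=> [p]; elim: p v => [|[e w] p IH] v /=.
  by move=> /contract_map_None Nv; exists v => //; exact: reachxx.
move=> [[tE hE] wp]; have [tO hO] := O'O e.
have [vt|[Nv _]] := contract_map_eq (etrans (esym tE) (esym tO)).
  rewrite -hE -hO in wp; have [n Nn rn] := IH _ wp.
  exists n => //; apply: reach_trans rn.
  by apply: (reach_step e); rewrite vt.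
by exists v => //; exact: reachxx.
Qed.

Lemma contract_reach_lift v : reach (dstep O') None (cm v) ->
  exists2 n, N n & reach (dstep O) n v.
Proof.
move=> [p wp].
(* The lift is built backwards from [v], so the start [c] must vary. The disjunct [N u] records that
   the lift has already stopped in [N]. *)
suff lift c : is_walk (dstep O') c p (cm v) ->
    exists2 u, reach (dstep O) u v & N u \/ cm u = c.
  by have [n rn [Nn|/contract_map_None Nn]] := lift _ wp; exists n.
elim: p c {wp} => [|[e w] p IH] c /=.
  by move=> ->; exists v; [exact: reachxx|right].
move=> [[tE hE] /IH[u ruv [Nu|uw]]]; first by exists u => //; left.
have [tO hO] := O'O e.
have [uh|[Nu _]] := contract_map_eq (etrans uw (etrans (esym hE) (esym hO))).
  exists (tail O e); last by right; rewrite -tE -tO.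
  by apply: reach_trans ruv; apply: (reach_step e); rewrite uh.
by exists u => //; left.
Qed.

Hypothesis wbO' : well_balanced O'.

Lemma upath_vertex_between {x p y v} : N x -> N y ->
  is_path (@ustep G) x p y -> v \in x :: unzip2 p ->
  between O N v.
Proof.
move=> Nx Ny [wp up] vp.
(* Well-balancedness concerns distinct vertices, so [v] must not be contracted. *)
have [Nv|nNv] := pselect (N v).
  by split; exists v => //; exact: reachxx.
have [p1 [p2 [pE w1 w2]]] := walk_split_at wp vp.
have disj := upath_split_edge_disjoint w1 w2 ltac:(by rewrite -pE).
have vN : cm v <> None by move=> /contract_map_None.
have [q1 w1' q1E] := uwalk_rev w1; have [q2 w2' q2E] := uwalk_rev w2.
have unzip1_cm (q : seq (edge G * vertex G)) :
    unzip1 [seq (z.1, cm z.2) | z <- q] = unzip1 q.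
  by rewrite /unzip1 -map_comp.
have [xN yN] : cm x = None /\ cm y = None by split; apply/contract_map_None.
(* The first piece is reversed to obtain two walks leaving [v], the second to obtain two walks
   arriving at [v]. *)
split; [apply: reach_contract_lift|apply: contract_reach_lift].
  move: (contract_uwalk w1') (contract_uwalk w2); rewrite xN yN => W1 W2.
  apply: (two_edge_disjoint_walks_reach wbO' vN W1 W2) => e.
  by rewrite !unzip1_cm q1E; exact: disj.
move: (contract_uwalk w1) (contract_uwalk w2'); rewrite xN yN => W1 W2.
apply: (two_edge_disjoint_walks_reach wbO' (nesym vN) W1 W2) => e.
by rewrite !unzip1_cm q2E; exact: disj.
Qed.

End Contraction.

(** * Components of the link graph along a walk *)

Section Linked.
Context {G : graph} {O : orientation G} {N : set (vertex G)}.
Implicit Types x y z : {x : vertex G | x \in N}.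
Let reachO := reach (dstep O).

(** Vertices may repeat, which makes transitivity plain concatenation. *)
Definition linked x y : Prop :=
  exists2 p, path (fun u v => `[< link_adj O u v >]) x p & last x p = y.

Lemma linked_trans {y x z} : linked x y -> linked y z -> linked x z.
Proof.
move=> [p pp lp] [q pq lq]; exists (p ++ q).
  by rewrite cat_path pp lp.
by rewrite last_cat lp.
Qed.

Lemma reach_linked {x y} :
  reachO (val x) (val y) \/ reachO (val y) (val x) -> linked x y.
Proof.
have [->|/eqP xy] := eqVneq x y; first by exists [::].
move=> rxy; exists [:: y] => //=; rewrite andbT; apply/asboolP; split=> //.
by case: rxy => -[p /walk_shorten[q qP _]]; [left|right]; exists q.
Qed.

Definition comparable_to (v : vertex G) x : Prop :=
  reachO (val x) v \/ reachO v (val x).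

(** If both reach [v], they reach a member of [N] beyond [v]; if [v] reaches both, a member of [N]
    before [v] does too. In the mixed cases one reaches the other through [v]. *)
Lemma comparable_linked {v x y} :
  between O N v -> comparable_to v x -> comparable_to v y -> linked x y.
Proof.
move=> [[n /mem_set Nn rvn] [m /mem_set Nm rmv]].
pose n' : {x : vertex G | x \in N} := exist _ n Nn.
pose m' : {x : vertex G | x \in N} := exist _ m Nm.
move=> [rx|rx] [ry|ry].
- apply: (linked_trans (y := n')); apply: reach_linked; [left|right];
    exact: reach_trans rvn.
- by apply: reach_linked; left; exact: reach_trans ry.
- by apply: reach_linked; right; exact: reach_trans rx.
- apply: (linked_trans (y := m')); apply: reach_linked; [right|left];
    exact: reach_trans rmv _.
Qed.

Lemma walk_linked {a p b x y} :
  is_walk (@ustep G) a p b ->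
  (forall v, v \in a :: unzip2 p -> between O N v) ->
  comparable_to a x -> comparable_to b y -> linked x y.
Proof.
elim: p a x => [|[e v] p IH] a x /=.
  move=> <- /(_ a); rewrite inE eqxx => /(_ isT); exact: comparable_linked.
move=> [sav wp] good cx cy.
have goodv u : u \in v :: unzip2 p -> between O N u.
  by move=> uvp; apply: good; rewrite inE uvp orbT.
have gooda := good a (mem_head _ _).
(* If the edge is directed from [a] to [v], a member of [N] reaching [a] also reaches [v]; otherwise
   a member reached from [a] is also reached from [v]. *)
have [s sa sv] : exists2 s, comparable_to a s & comparable_to v s.
  have [[n /mem_set Nn ran] [m /mem_set Nm rma]] := gooda.
  have [rav|rva] := ustep_reach O sav.
    exists (exist _ m Nm); [by left|left; exact: reach_trans rav].
  exists (exist _ n Nn); [by right|right; exact: reach_trans ran].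
apply: (linked_trans (y := s)); first exact: comparable_linked gooda cx sa.
exact: (IH v).
Qed.

End Linked.

Theorem theorem4p15 (G : graph) (N : set (vertex G))
    (conG : connected G) (N0 : N !=set0) (indN : independent N)
    (O' : orientation (contract indN)) (wbO' : well_balanced O')
    (O : orientation G) (O'O : induces O' O) :
  sconnected (L O N).
Proof.
have [n Nn] := N0; split; first by exists (exist _ n (mem_set Nn)).
move=> x y; have [_ /(_ (val x) (val y))[p pP]] := conG.
have [Nx Ny] : N (val x) /\ N (val y).
  by split; apply: set_mem; [exact: (valP x)|exact: (valP y)].
have [q pq <-] : linked (O := O) x y.
  apply: (walk_linked pP.1); last by left; exact: reachxx.
    by move=> v vp; exact: (upath_vertex_between O'O wbO' Nx Ny pP vp).
  by left; exact: reachxx.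
(* Repeated vertices are removed only here, since [sconnected] asks for a path. *)
by case: (shortenP pq) => r pr ur _; exists r.
Qed.
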